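(* Let $C_{(0)}:\mathrm{ces}(0)\to\mathrm{ces}(0)$ be the Cesàro operator $C_{(0)}(x)=\left(\frac1n\sum_{k=1}^n x_k\right)_{n=1}^\infty$, $x=(x_n)_{n=1}^\infty\in\mathrm{ces}(0)$, which is a positive operator belonging to $\mathcal{L}(\mathrm{ces}(0))$. Then its order spectrum coincides with its spectrum, that is, $\sigma_{\rm o}(C_{(0)})=\sigma(C_{(0)})$.
   Context: $\mathbb{N}=\{1,2,\ldots\}$. The space $\mathrm{ces}(0)$ is $$\mathrm{ces}(0)=\Big\{x\in\mathbb{C}^{\mathbb{N}}:\Big(\frac1n\sum_{k=1}^n|x_k|\Big)_{n=1}^\infty\in c_0\Big\},\qquad \|x\|_{\mathrm{ces}(0)}=\sup_{n\in\mathbb{N}}\frac1n\sum_{k=1}^n|x_k|,$$ which is a complex Banach lattice for this norm and the coordinatewise order. It is known that the Cesàro operator maps $\mathrm{ces}(0)$ continuously into itself. For a complex Banach lattice $E$, $\mathcal{L}(E)$ is the unital Banach algebra of all continuous linear operators $E\to E$ (unit: the identity $I$). The spectrum of $T\in\mathcal{L}(E)$ is $\sigma(T)=\{\lambda\in\mathbb{C}:\lambda I-T \text{ is not invertible in }\mathcal{L}(E)\}$. An operator $T\in\mathcal{L}(E)$ is regular if it is a finite (complex) linear combination of positive operators; $\mathcal{L}^r(E)$ denotes the set of all regular operators, which is a unital algebra (a Banach algebra for the norm $\|T\|_r=\inf\{\|S\|_{\rm op}:S\in\mathcal{L}(E),\,S\ge0,\,|T(z)|\le S(|z|)\ \forall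 z\in E\}$). The order spectrum of $T\in\mathcal{L}^r(E)$ is $\sigma_{\rm o}(T)=\{\lambda\in\mathbb{C}:\lambda I-T\text{ is not invertible in }\mathcal{L}^r(E)\}$. *)

(* Defs.v *)
From HB Require Import structures.
From mathcomp Require Import all_boot all_order all_algebra complex.
From mathcomp Require Import all_classical all_reals all_analysis.

Set Implicit Arguments.
Unset Strict Implicit.
Unset Printing Implicit Defensive.

Import Order.TTheory GRing.Theory Num.Theory.
Import numFieldNormedType.Exports.
Import Normc.

Local Open Scope classical_set_scope.
Local Open Scope ring_scope.
Local Open Scope complex_scope.

Section spectrum.
Context {K : numDomainType} {E : normedModType K}.

Definition bounded_operators : set (E -> E) :=
  [set T | linear T /\ continuous T].

Definition invertible_in (A : set (E -> E)) (T : E -> E) : Prop :=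
  exists S, [/\ A S, cancel T S & cancel S T].

Definition spectrum_in (A : set (E -> E)) (T : E -> E) : set K :=
  [set l | ~ invertible_in A (fun x => l *: x - T x)].

Definition spectrum (T : E -> E) : set K := spectrum_in bounded_operators T.

End spectrum.

Section ces0_type.
Variable R : realType.
Implicit Types x y : nat -> R[i].

(* Sequences are indexed from 0: the entry x n stands for x_{n+1}, and
   [arithmetic_mean u n] is the mean of the n+1 entries u 0, ..., u n.
   [normc] is the R-valued modulus: `|z| = (normc z)%:C. *)
Definition abs_mean x : R ^nat := arithmetic_mean (fun k => normc (x k)).

Definition ces0_pred : {pred nat -> R[i]} :=
  fun x => `[< abs_mean x @ \oo --> (0 : R) >].

Lemma normc_ge0 (z : R[i]) : 0 <= normc z.
Proof. by case: z => a b; exact: sqrtr_ge0. Qed.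

Lemma ler_normc_sum (I : Type) (s : seq I) (F : I -> R[i]) :
  normc (\sum_(i <- s) F i) <= \sum_(i <- s) normc (F i).
Proof.
elim: s => [|i s IH]; first by rewrite !big_nil normc0.
by rewrite !big_cons (le_trans (le_normcD _ _))// lerD2l.
Qed.

Lemma normc_nat n : normc (n%:R : R[i]) = n%:R.
Proof. by have := @normcMn R 1 n; rewrite normc1. Qed.

Lemma abs_mean_ge0 x n : 0 <= abs_mean x n.
Proof.
rewrite /abs_mean /arithmetic_mean /= mulr_ge0// ?invr_ge0//.
by rewrite /series /= sumr_ge0// => k _; exact: normc_ge0.
Qed.

Lemma abs_meanD x y n : abs_mean (x + y) n <= abs_mean x n + abs_mean y n.
Proof.
rewrite /abs_mean /arithmetic_mean /= -mulrDr ler_wpM2l ?invr_ge0//.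
by rewrite /series /= -big_split ler_sum// => k _; exact: le_normcD.
Qed.

Lemma abs_meanZ (l : R[i]) x n : abs_mean (l *: x) n = normc l * abs_mean x n.
Proof.
rewrite /abs_mean /arithmetic_mean /= mulrCA; congr (_ * _).
by rewrite /series /= mulr_sumr; apply: eq_bigr => k _; rewrite -normcM.
Qed.

Lemma ces0_submod_closed : submod_closed ces0_pred.
Proof.
split.
  apply/asboolP; rewrite /abs_mean (_ : (fun k => _) = fun=> 0).
    exact: (cesaro (cvg_cst _)).
  by apply/funext => k; exact: normc0.
move=> l x y /asboolP x0 /asboolP y0; apply/asboolP.
apply: (@squeeze_cvgr _ _ _ _ (fun=> 0)
          (fun n => normc l * abs_mean x n + abs_mean y n)).
- by apply: nearW => n; rewrite abs_mean_ge0/= -abs_meanZ; exact: abs_meanD.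
- exact: cvg_cst.
- rewrite -[X in _ --> X]addr0; apply: cvgD => //.
  rewrite -[X in _ --> X](mulr0 (normc l)); apply: cvgM => //; exact: cvg_cst.
Qed.

HB.instance Definition _ :=
  GRing.isSubmodClosed.Build R[i] (nat -> R[i]) ces0_pred ces0_submod_closed.

Record ces0 := Ces0 { ces0_val :> nat -> R[i]; _ : ces0_val \in ces0_pred }.

HB.instance Definition _ := [isSub for ces0_val].
HB.instance Definition _ := [Choice of ces0 by <:].
HB.instance Definition _ := [SubChoice_isSubLmodule of ces0 by <:].

Lemma ces0_eqP (x y : ces0) : (forall n, x n = y n) -> x = y.
Proof. by move=> xy; apply: val_inj; apply/funext. Qed.

Lemma abs_mean_cvg0 (x : ces0) : abs_mean x @ \oo --> (0 : R).
Proof. by case: x => x /= /asboolP. Qed.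

Lemma abs_mean_has_sup (x : ces0) : has_sup (range (abs_mean x)).
Proof. by apply: cvg_has_sup; apply/cvg_ex; exists 0; exact: abs_mean_cvg0. Qed.

Definition ces0_rnorm (x : ces0) : R := sup (range (abs_mean x)).

(* The norm of a normed module over R[i] takes its values in R[i]. *)
Definition ces0_norm (x : ces0) : R[i] := (ces0_rnorm x)%:C.

Lemma le_ces0_rnorm (x : ces0) n : abs_mean x n <= ces0_rnorm x.
Proof.
by apply: sup_upper_bound; [exact: abs_mean_has_sup|exists n].
Qed.

Lemma ces0_rnorm_le (x : ces0) M :
  (forall n, abs_mean x n <= M) -> ces0_rnorm x <= M.
Proof.
move=> xM; apply: ge_sup; first by exists (abs_mean x 0%N); exists 0%N.
by move=> _ [n _ <-].
Qed.

Lemma ces0_rnorm_ge0 (x : ces0) : 0 <= ces0_rnorm x.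
Proof. exact: le_trans (abs_mean_ge0 x 0%N) (le_ces0_rnorm x 0%N). Qed.

Lemma ces0_normD (x y : ces0) : ces0_norm (x + y) <= ces0_norm x + ces0_norm y.
Proof.
rewrite /ces0_norm -rmorphD lecR; apply: ces0_rnorm_le => n.
by rewrite (le_trans (abs_meanD _ _ _))// lerD// le_ces0_rnorm.
Qed.

Lemma ces0_normZ (l : R[i]) (x : ces0) :
  ces0_norm (l *: x) = `|l| * ces0_norm x.
Proof.
rewrite (_ : `|l| = (normc l)%:C)// /ces0_norm -rmorphM; congr _%:C.
have le_rnormZ (m : R[i]) (y : ces0) :
    ces0_rnorm (m *: y) <= normc m * ces0_rnorm y.
  apply: ces0_rnorm_le => n.
  by rewrite [leLHS]abs_meanZ ler_wpM2l ?normc_ge0 ?le_ces0_rnorm.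
apply/eqP; rewrite eq_le le_rnormZ /=.
have [->|l0] := eqVneq l 0; first by rewrite normc0 mul0r ces0_rnorm_ge0.
have nl0 : 0 < normc l.
  rewrite lt_neqAle normc_ge0 andbT eq_sym.
  by apply: contra l0 => /eqP/eq0_normc ->.
have := le_rnormZ l^-1 (l *: x).
by rewrite scalerA mulVf// scale1r normcV ler_pdivlMl.
Qed.

Lemma ces0_norm0_eq0 (x : ces0) : ces0_norm x = 0 -> x = 0.
Proof.
move=> [x0]; apply: ces0_eqP => n; apply: eq0_normc; apply/eqP.
have : abs_mean x n <= 0 by rewrite -x0 le_ces0_rnorm.
rewrite /abs_mean /arithmetic_mean /= pmulr_rle0 ?invr_gt0// => s0.
rewrite eq_le normc_ge0 andbT (le_trans _ s0)// /series /= big_nat_recr//=.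
by rewrite lerDr sumr_ge0// => k _; exact: normc_ge0.
Qed.

HB.instance Definition _ :=
  @Lmodule_isNormed.Build R[i] ces0 ces0_norm ces0_normD ces0_normZ
    ces0_norm0_eq0.

(* On R[i], z <= w means that w - z is a nonnegative real number. *)
Definition ces0_le (x y : ces0) : bool := `[< forall n, x n <= y n >].

Lemma ces0_le_refl : reflexive ces0_le.
Proof. by move=> x; apply/asboolP. Qed.

Lemma ces0_le_anti : antisymmetric ces0_le.
Proof.
move=> x y /andP[/asboolP xy /asboolP yx]; apply: ces0_eqP => n.
by apply: le_anti; rewrite xy yx.
Qed.

Lemma ces0_le_trans : transitive ces0_le.
Proof.
move=> y x z /asboolP xy /asboolP yz; apply/asboolP => n.
exact: le_trans (xy n) (yz n).
Qed.

HB.instance Definition _ := Order.Le_isPOrder.Build orderedzmod.ring_display ces0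
  ces0_le_refl ces0_le_anti ces0_le_trans.

Lemma abs_mean_cesaro x n :
  abs_mean (arithmetic_mean x) n <= arithmetic_mean (abs_mean x) n.
Proof.
rewrite /abs_mean {1 3}/arithmetic_mean /= ler_wpM2l ?invr_ge0//.
rewrite /series /= ler_sum// => k _.
rewrite /arithmetic_mean /= normcM normcV normc_nat ler_wpM2l ?invr_ge0//.
exact: ler_normc_sum.
Qed.

Lemma cesaro_subproof (x : ces0) :
  arithmetic_mean (x : nat -> R[i]) \in ces0_pred.
Proof.
apply/asboolP.
apply: (@squeeze_cvgr _ _ _ _ (fun=> 0) (arithmetic_mean (abs_mean x))).
- by apply: nearW => n; rewrite abs_mean_ge0/= abs_mean_cesaro.
- exact: cvg_cst.
- exact/cesaro/abs_mean_cvg0.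
Qed.

Definition cesaro_op (x : ces0) : ces0 := Ces0 (cesaro_subproof x).

End ces0_type.

Section regular_operators.
Variable R : realType.
Implicit Types T : ces0 R -> ces0 R.

Definition positive_op T : Prop := forall x, 0 <= x -> 0 <= T x.

Definition regular_operators : set (ces0 R -> ces0 R) :=
  [set T | exists (n : nat) (c : 'I_n -> R[i]) (S : 'I_n -> ces0 R -> ces0 R),
     (forall i, bounded_operators (S i) /\ positive_op (S i)) /\
     (forall x, T x = \sum_(i < n) c i *: S i x)].

Definition order_spectrum T : set R[i] := spectrum_in regular_operators T.

End regular_operators.

(* Main.v *)
(* For z with Re z < 1 the equation w = C (y + z w) is a first-order recursion
   with a unique solution w = A_z y.  If l <> 0 and z = 1/l, then z I + z^2 A_z is
   the inverse of l I - C, so only two things are to be shown.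
   First, if Re z <= a with 0 <= a < 1, then |n - z| >= n - a gives
   |A_z y| <= A_a |y|, and the positive operator A_a commutes with taking means and
   has sup-norm at most 1/(1 - a); hence A_a is bounded on ces(0) and A_z, being
   dominated by it, is regular.
   Second, if l I - C has a bounded inverse, then l <> 0 and Re (1/l) < 1: for
   l = 0 the inverse is unbounded on the unit vectors, and for Re (1/l) >= 1 the
   means of the preimage of the first unit vector do not tend to 0. *)
Require Import Defs.
From HB Require Import structures.
From mathcomp Require Import all_boot all_order all_algebra complex.
From mathcomp Require Import all_classical all_reals all_analysis.
From mathcomp Require Import ring lra.

Set Implicit Arguments.
Unset Strict Implicit.
Unset Printing Implicit Defensive.

Import Order.TTheory GRing.Theory Num.Theory.
Import numFieldNormedType.Exports.
Import Normc.

Local Open Scope classical_set_scope.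
Local Open Scope ring_scope.
Local Open Scope complex_scope.

(** * The recursion solving w = C(y + z w) *)

Section cesaro_recursion.
Context {F : numFieldType}.
Implicit Types (z : F) (u w y : nat -> F) (n : nat).

(** This is A_z y, formally (I - z C)^-1 C y. Multiplying the equation w = C(y + z w) at index n by
    n+1 and subtracting n times the one at n-1 leaves (n + 1 - z) w_n = n w_(n-1) + y_n. *)
Fixpoint cesaro_res z y n : F :=
  if n is n'.+1 then (n%:R * cesaro_res z y n' + y n) / (n.+1%:R - z)
  else y 0 / (1 - z).

Lemma arithmetic_mean0 u : arithmetic_mean u 0 = u 0%N.
Proof. by rewrite /arithmetic_mean /= /series /= big_nat1 invr1 mul1r. Qed.

Lemma arithmetic_meanS u n :
  arithmetic_mean u n.+1 = (n.+1%:R * arithmetic_mean u n + u n.+1) / n.+2%:R.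
Proof.
rewrite /arithmetic_mean /= /series /= [in LHS]big_nat_recr//=.
by rewrite mulVKf ?pnatr_eq0// mulrC.
Qed.

Lemma arithmetic_meanD u w n :
  arithmetic_mean (u \+ w) n = arithmetic_mean u n + arithmetic_mean w n.
Proof. by rewrite /arithmetic_mean /= /series /= big_split mulrDr. Qed.

Lemma arithmetic_meanZ z u n :
  arithmetic_mean (fun k => z * u k) n = z * arithmetic_mean u n.
Proof. by rewrite /arithmetic_mean /= /series /= -mulr_sumr mulrCA. Qed.

Lemma cesaro_res_eq z y n : (forall k, k.+1%:R - z != 0) ->
  arithmetic_mean (fun k => y k + z * cesaro_res z y k) n = cesaro_res z y n.
Proof.
move=> z0; elim: n => [|n IHn].
  by rewrite arithmetic_mean0 /=; field; exact: z0 0%N.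
rewrite arithmetic_meanS IHn; apply: (canLR (mulfK _)); first by rewrite pnatr_eq0.
have : cesaro_res z y n.+1 * (n.+2%:R - z) = n.+1%:R * cesaro_res z y n + y n.+1.
  by rewrite /= divfK// z0.
by rewrite addrA mulrBr => <-; ring.
Qed.

Lemma cesaro_res_unique z y w : (forall k, k.+1%:R - z != 0) ->
  (forall n, arithmetic_mean (fun k => y k + z * w k) n = w n) ->
  forall n, w n = cesaro_res z y n.
Proof.
move=> z0 yw; elim=> [|n IHn] /=.
  have := yw 0%N; rewrite arithmetic_mean0 => e.
  by apply: (mulIf (z0 0%N)); rewrite divfK ?(z0 0%N)// mulrBr -{1}e; ring.
have := yw n.+1; rewrite arithmetic_meanS yw -IHn => /(canRL (divfK _)) e.
apply: (mulIf (z0 n.+1)); rewrite divfK ?z0//.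
rewrite mulrBr -e ?pnatr_eq0//; ring.
Qed.

End cesaro_recursion.

(** * Commutation with means, and linearity *)

Section cesaro_res_theory.
Context {F : numFieldType}.
Implicit Types (z : F) (u w y : nat -> F) (n : nat).

Lemma arithmetic_mean_cst z n : arithmetic_mean (fun=> z) n = z.
Proof.
by rewrite /arithmetic_mean /= /series /= sumr_const_nat subn0 -[z *+ _]mulr_natl
  mulKf// pnatr_eq0.
Qed.

(** Applying C to w = C(y + z w) shows that C w solves the same equation with C y in place of y;
    uniqueness concludes. *)
Lemma arithmetic_mean_cesaro_res z y n : (forall k, k.+1%:R - z != 0) ->
  arithmetic_mean (cesaro_res z y) n = cesaro_res z (arithmetic_mean y) n.
Proof.
move=> z0; apply: (cesaro_res_unique z0) => {}n; congr (arithmetic_mean _ n).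
apply/funext => k; rewrite -arithmetic_meanZ -[LHS]arithmetic_meanD.
exact: cesaro_res_eq.
Qed.

Lemma cesaro_resD z u w n :
  cesaro_res z (u + w) n = cesaro_res z u n + cesaro_res z w n.
Proof. elim: n => [|n /= ->]; first exact: mulrDl.
by rewrite -mulrDl; congr (_ / _); rewrite mulrDr addrACA. Qed.

Lemma cesaro_resZ z c u n :
  cesaro_res z (c *: u : nat -> F^o) n = c * cesaro_res z u n.
Proof. elim: n => [|n /= ->]; first by rewrite /= mulrA.
by rewrite [RHS]mulrA; congr (_ / _); rewrite mulrDr mulrCA. Qed.

End cesaro_res_theory.

(** * Real parameter in [0,1): positivity, sup bound, null sequences *)

Section cesaro_res_real.
Context {R : realType} (a : R).
Hypothesis (a_ge0 : 0 <= a) (a_lt1 : a < 1).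
Implicit Types (u w y : nat -> R) (n : nat).

Lemma ler_arithmetic_mean u w n :
  (forall k, u k <= w k) -> arithmetic_mean u n <= arithmetic_mean w n.
Proof.
by move=> uw; rewrite /arithmetic_mean /= ler_wpM2l ?invr_ge0// ler_sum.
Qed.

Lemma cesaro_res_den_gt0 n : 0 < n.+1%:R - a.
Proof. by rewrite subr_gt0 (lt_le_trans a_lt1)// ler1n. Qed.

Let den_neq0 n : n.+1%:R - a != 0.
Proof. by rewrite gt_eqF// cesaro_res_den_gt0. Qed.

Lemma cesaro_res_ge0 y n : (forall k, 0 <= y k) -> 0 <= cesaro_res a y n.
Proof.
move=> y0; elim: n => [|n IHn] /=; rewrite divr_ge0//.
- exact: ltW (cesaro_res_den_gt0 0).
- by rewrite addr_ge0// mulr_ge0.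
- exact: ltW (cesaro_res_den_gt0 n.+1).
Qed.

(** The constant M / (1 - a) is the solution for y constantly equal to M, so induction along the
    recursion keeps the bound. *)
Lemma cesaro_res_le y M n :
  (forall k, y k <= M) -> cesaro_res a y n <= M / (1 - a).
Proof.
move=> yM; have a1 := cesaro_res_den_gt0 0.
elim: n => [|n IHn] /=; first by rewrite ler_pM2r ?invr_gt0.
rewrite ler_pdivrMr ?cesaro_res_den_gt0//.
apply: le_trans (lerD (ler_wpM2l _ IHn) (yM n.+1)) _ => //.
rewrite le_eqVlt; apply/orP; left; apply/eqP.
rewrite -{2}[M](divfK (lt0r_neq0 a1)).
by rewrite -[n.+2]addn1 natrD; ring.
Qed.

(* Iterating w = C(y + a w) gives w <= g + a^j K with g a null sequence, for
   every j: a finite stage of the Neumann series of (I - a C)^-1. *)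
Lemma cesaro_res_cvg0 y M : (forall k, 0 <= y k <= M) ->
  y @ \oo --> (0 : R) -> cesaro_res a y @ \oo --> (0 : R).
Proof.
move=> y_bnd y0; set w := cesaro_res a y; set K := M / (1 - a).
have w_ge0 n : 0 <= w n by apply: cesaro_res_ge0 => k; case/andP: (y_bnd k).
have K_ge0 : 0 <= K.
  by rewrite (le_trans (w_ge0 0%N))// cesaro_res_le// => k; case/andP: (y_bnd k).
have wg j : exists2 g : nat -> R, g @ \oo --> (0 : R) &
    forall n, w n <= g n + a ^+ j * K.
  elim: j => [|j [g g0 wg]].
    exists (fun=> 0) => [|n]; first exact: cvg_cst.
    by rewrite add0r expr0 mul1r cesaro_res_le// => k; case/andP: (y_bnd k).
  exists (arithmetic_mean (fun k => y k + a * g k)) => [|n].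
    apply: cesaro; rewrite -[X in _ --> X]addr0; apply: cvgD => //.
    by rewrite -[X in _ --> X](mulr0 a); apply: cvgM => //; exact: cvg_cst.
  rewrite -(arithmetic_mean_cst (_ * K) n) -arithmetic_meanD /w.
  rewrite -cesaro_res_eq//; apply: ler_arithmetic_mean => k /=.
  by rewrite -addrA lerD2l exprS -mulrA -mulrDr ler_wpM2l.
apply/cvgr0Pnorm_lt => e e0.
(* The stage j is fixed first, with a^j K < e/2; only then is n taken large, for the null sequence g
   belonging to that j. *)
have /cvgr0Pnorm_lt/(_ _ (divr_gt0 e0 (ltr0n R 2)))[j _ /(_ j (leqnn j)) ajK] :
    (fun j => a ^+ j * K) @ \oo --> (0 : R).
  rewrite -[X in _ --> X](mul0r K); apply: cvgM; last exact: cvg_cst.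
  by apply: cvg_expr; rewrite ger0_norm.
have [g /cvgr0Pnorm_lt/(_ _ (divr_gt0 e0 (ltr0n R 2))) ge wge] := wg j.
near=> n; rewrite ger0_norm//.
have := wge n; move: ajK => /=; rewrite (ger0_norm (mulr_ge0 (exprn_ge0 j a_ge0) K_ge0)) => ajK wn.
apply: le_lt_trans wn _; rewrite [e]splitr ltrD//.
by apply: le_lt_trans (ler_norm _) _; near: n.
Unshelve. all: by end_near.
Qed.

End cesaro_res_real.

(** * Complex parameter: domination by the real case, and A_z on ces(0) *)

Section cesaro_res_complex.
Context {R : realType}.
Implicit Types (z : R[i]) (a : R) (x y : nat -> R[i]) (n : nat).

Lemma normr_Re_le_normc z : `|complex.Re z| <= normc z.
Proof.
by case: z => s t /=; rewrite -sqrtr_sqr ler_sqrt ?addr_ge0 ?sqr_ge0// lerDl sqr_ge0.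
Qed.

Lemma normr_Im_le_normc z : `|complex.Im z| <= normc z.
Proof.
by case: z => s t /=; rewrite -sqrtr_sqr ler_sqrt ?addr_ge0 ?sqr_ge0// lerDr sqr_ge0.
Qed.

Lemma Re_natB n z : complex.Re (n%:R - z) = n%:R - complex.Re z.
Proof.
have -> : n%:R = (n%:R)%:C :> R[i] by rewrite rmorph_nat.
by case: z.
Qed.

Lemma natB_neq0 z n : complex.Re z < 1 -> n.+1%:R - z != 0.
Proof.
move=> z1; apply/eqP => /(congr1 (@complex.Re R)); rewrite Re_natB => /eqP.
by rewrite /= gt_eqF// subr_gt0 (lt_le_trans z1)// ler1n.
Qed.

Lemma normc_cesaro_res z a x n : complex.Re z <= a -> 0 <= a -> a < 1 ->
  normc (cesaro_res z x n) <= cesaro_res a (fun k => normc (x k)) n.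
Proof.
move=> za a_ge0 a_lt1.
have den k : k.+1%:R - a <= normc (k.+1%:R - z).
  apply: le_trans (le_trans (ler_norm _) (normr_Re_le_normc _)).
  by rewrite Re_natB lerD2l lerN2.
have normc_div (u v : R[i]) r s :
    normc u <= r -> 0 < s -> s <= normc v -> normc (u / v) <= r / s.
  move=> ur s0 sv; rewrite normcM normcV.
  rewrite ler_pM ?invr_ge0 ?normc_ge0// lef_pV2// posrE//.
  exact: lt_le_trans sv.
elim: n => [|n IHn] /=; apply: normc_div; rewrite ?cesaro_res_den_gt0//.
- exact: cesaro_res_den_gt0 a_lt1 0.
- exact: den 0.
- apply: le_trans (le_normcD _ _) _; rewrite lerD2r normcM normc_nat.
  by rewrite ler_wpM2l.
Qed.

Section dominated.
Variables (z : R[i]) (a : R).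
Hypotheses (za : complex.Re z <= a) (a_ge0 : 0 <= a) (a_lt1 : a < 1).

(** Membership in ces(0) controls only the means of |x|. Averaging the pointwise domination and
    moving the mean inside [cesaro_res a] reduces everything to these means. *)
Lemma abs_mean_cesaro_res x n :
  abs_mean (cesaro_res z x) n <= cesaro_res a (abs_mean x) n.
Proof.
rewrite /abs_mean -arithmetic_mean_cesaro_res; last first.
  by move=> k; rewrite gt_eqF// cesaro_res_den_gt0.
by apply: ler_arithmetic_mean => k; exact: normc_cesaro_res.
Qed.

Lemma cesaro_res_ces0 (x : ces0 R) :
  cesaro_res z (x : nat -> R[i]) \in @ces0_pred R.
Proof.
apply/asboolP.
apply: (@squeeze_cvgr _ _ _ _ (fun=> 0) (cesaro_res a (abs_mean x))).
- by apply: nearW => n; rewrite abs_mean_ge0/= abs_mean_cesaro_res.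
- exact: cvg_cst.
- apply: (cesaro_res_cvg0 a_ge0 a_lt1 (M := ces0_rnorm x)).
    by move=> k; rewrite abs_mean_ge0 le_ces0_rnorm.
  exact: abs_mean_cvg0.
Qed.

Definition cesaro_res_op (x : ces0 R) : ces0 R := Ces0 (cesaro_res_ces0 x).

Lemma ces0_rnorm_cesaro_res_op (x : ces0 R) :
  ces0_rnorm (cesaro_res_op x) <= ces0_rnorm x / (1 - a).
Proof.
apply: ces0_rnorm_le => n; apply: le_trans (abs_mean_cesaro_res _ _) _.
by apply: cesaro_res_le => // k; exact: le_ces0_rnorm.
Qed.

End dominated.

End cesaro_res_complex.

(** * Bounded operators on ces(0) *)

Section bounded_operators_theory.
Context {R : realType}.
Implicit Types T S : ces0 R -> ces0 R.

Lemma bounded_operators_of_le T M :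
  linear T -> (forall x, ces0_rnorm (T x) <= ces0_rnorm x * M) ->
  bounded_operators T.
Proof.
move=> Tlin TM; split => //.
pose f := HB.pack_for {linear ces0 R -> ces0 R} T
  (@GRing.isLinear.Build _ _ _ _ T Tlin).
apply: (@bounded_linear_continuous _ _ _ f).
apply/linear_boundedP; near=> r => x.
rewrite -[`|f x|]/((ces0_rnorm (T x))%:C) -[`|x|]/((ces0_rnorm x)%:C).
(* The bound [r] runs through R[i] near +oo; it eventually exceeds M because M is real there. *)
have Mr : M%:C <= r.
  by near: r; apply: nbhs_pinfty_ge; rewrite realE -[0]/(0%:C) !lecR le_total.
apply: (@le_trans _ _ (M%:C * (ces0_rnorm x)%:C)).
  by rewrite -rmorphM/= lecR mulrC.
by rewrite ler_wpM2r// lecR ces0_rnorm_ge0.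
Unshelve. all: by end_near.
Qed.

Lemma bounded_operatorsD S T : bounded_operators S -> bounded_operators T ->
  bounded_operators (fun x => S x + T x).
Proof.
move=> [Sl Sc] [Tl Tc]; split.
  by move=> c x y; rewrite Sl Tl scalerDr addrACA.
by move=> x; exact: (cvgD (Sc x) (Tc x)).
Qed.

Lemma bounded_operatorsZ c T : bounded_operators T ->
  bounded_operators (fun x => c *: T x).
Proof.
move=> [Tl Tc]; split.
  by move=> d x y; rewrite Tl scalerDr !scalerA mulrC.
by move=> x; exact: (cvgZl_tmp (k := c) (Tc x)).
Qed.

Lemma bounded_operators_id : bounded_operators (@id (ces0 R)).
Proof. by split=> // x; exact: cvg_id. Qed.

Lemma bounded_operators_cst0 : bounded_operators (fun=> 0 : ces0 R).
Proof.
by split=> [c x y|x]; [rewrite scaler0 addr0|apply: (@cst_continuous _ _ (0 : ces0 R))].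
Qed.

(** Source of the easy inclusion, of the spectrum in the order spectrum. *)
Lemma regular_bounded T : regular_operators T -> bounded_operators T.
Proof.
move=> [n [c [S [S_bnd /funext ->]]]].
elim: n => [|n IHn] in c S S_bnd *.
  under eq_fun do rewrite big_ord0.
  exact: bounded_operators_cst0.
under eq_fun do rewrite big_ord_recr /=.
apply: bounded_operatorsD; first exact: IHn (fun i => S_bnd _).
by apply: bounded_operatorsZ; case: (S_bnd ord_max).
Qed.

Lemma cesaro_op_bounded : bounded_operators (@cesaro_op R).
Proof.
apply: (bounded_operators_of_le (M := 1)).
  move=> c x y; apply: ces0_eqP => n /=.
  rewrite -[RHS]/(c * _ + _) -arithmetic_meanZ -arithmetic_meanD.
  by congr (arithmetic_mean _ n).
move=> x; rewrite mulr1; apply: ces0_rnorm_le => n.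
apply: le_trans (abs_mean_cesaro _ _) _.
rewrite -(arithmetic_mean_cst (ces0_rnorm x) n).
by apply: ler_arithmetic_mean => k; exact: le_ces0_rnorm.
Qed.

Lemma ces0_geP (x : ces0 R) : 0 <= x <-> (forall n, 0 <= x n).
Proof. by split => [/asboolP|] x0 //; apply/asboolP. Qed.

Lemma cesaro_op_positive : positive_op (@cesaro_op R).
Proof.
move=> x /ces0_geP x0; apply/ces0_geP => n /=.
by rewrite /arithmetic_mean /= mulr_ge0 ?invr_ge0 ?ler0n//= /series /= sumr_ge0.
Qed.

End bounded_operators_theory.

(** * The inverse of l I - C and its regularity *)

Section regularity.
Context {R : realType}.
Implicit Types (z l : R[i]) (a : R) (n : nat).

(** Serves for two morphisms: the embedding of R in R[i] and complex conjugation. *)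
Lemma rmorph_cesaro_res (F G : numFieldType) (f : {rmorphism F -> G})
    (z : F) (x : nat -> F) n :
  f (cesaro_res z x n) = cesaro_res (f z) (f \o x) n.
Proof.
by elim: n => [|n IHn] /=; rewrite fmorph_div rmorphB ?rmorph1 ?rmorph_nat//
  rmorphD rmorphM rmorph_nat IHn.
Qed.

Section bounded.
Variables (z : R[i]) (a : R).
Hypotheses (za : complex.Re z <= a) (a_ge0 : 0 <= a) (a_lt1 : a < 1).

Lemma cesaro_res_op_bounded :
  bounded_operators (cesaro_res_op za a_ge0 a_lt1).
Proof.
apply: (bounded_operators_of_le (M := (1 - a)^-1)).
  move=> c x y; apply: ces0_eqP => n.
  rewrite -[RHS]/(c * cesaro_res z x n + cesaro_res z y n) -cesaro_resZ.
  exact: cesaro_resD.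
by move=> x; exact: ces0_rnorm_cesaro_res_op.
Qed.

(** With w = A_z x one has S x = z (x + z w), whose mean is z w by the defining equation; since l z
    = 1, the two terms z w cancel. *)
Lemma cesaro_res_op_inverse l (x : ces0 R) : l != 0 -> z = l^-1 ->
  let S y := z *: y + z ^+ 2 *: cesaro_res_op za a_ge0 a_lt1 y in
  l *: S x - cesaro_op (S x) = x /\ S (l *: x - cesaro_op x) = x.
Proof.
move=> l0 zl S; have z0 k := natB_neq0 k (le_lt_trans za a_lt1).
have lz : l * z = 1 by rewrite zl divff.
split; apply: ces0_eqP => n.
  set w := cesaro_res z x.
  have SE k : S x k = z * (x k + z * w k) by rewrite mulrDr mulrA.
  rewrite -[LHS]/(l * S x n - arithmetic_mean (S x) n) SE.
  rewrite (_ : arithmetic_mean (S x) n = z * w n); last first.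
    by rewrite (funext SE) arithmetic_meanZ cesaro_res_eq.
  by rewrite mulrA lz mul1r addrK.
set y := l *: x - cesaro_op x.
have yE k : y k = l * x k - arithmetic_mean x k by [].
(* As y + z l C x = l x, the sequence l C x solves w = C(y + z w), hence equals A_z y by
   uniqueness. *)
have wE : l * arithmetic_mean x n = cesaro_res z y n.
  rewrite -(cesaro_res_unique z0 (w := fun k => l * arithmetic_mean x k))//.
  move=> k; rewrite -arithmetic_meanZ; congr (arithmetic_mean _ k).
  by apply/funext => i; rewrite yE mulrA [z * l]mulrC lz mul1r subrK.
rewrite -[LHS]/(z * y n + z ^+ 2 * cesaro_res z y n) -wE yE expr2 -mulrA.
by rewrite [z * (l * _)]mulrA [z * l]mulrC lz mul1r mulrBr mulrA [z * l]mulrC lz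
  mul1r subrK.
Qed.

End bounded.

(* With A_z := cesaro_res_op at z, |A_z x| <= A_a |x| for Re z <= a, so that
   A_a + Re A_z and A_a + Im A_z are positive, where Re A_z = (A_z + A_w)/2
   and Im A_z = (A_z - A_w)/(2i) for w the conjugate of z. *)
Lemma regular_cesaro_res_op z a (za : complex.Re z <= a) (a_ge0 : 0 <= a)
    (a_lt1 : a < 1) (u v : R[i]) :
  regular_operators (fun x => u *: x + v *: cesaro_res_op za a_ge0 a_lt1 x).
Proof.
have zca : complex.Re z^* <= a by case: (z) za.
have aa : complex.Re a%:C <= a by [].
pose A := cesaro_res_op za a_ge0 a_lt1.
pose Ac := cesaro_res_op zca a_ge0 a_lt1.
pose P := cesaro_res_op aa a_ge0 a_lt1.
pose S1 x := P x + 2^-1 *: (A x + Ac x).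
pose S2 x := P x + (2 * 'i)^-1 *: (A x + (-1) *: Ac x).
have bA : bounded_operators A by exact: cesaro_res_op_bounded.
have bAc : bounded_operators Ac by exact: cesaro_res_op_bounded.
have bP : bounded_operators P by exact: cesaro_res_op_bounded.
have bS1 : bounded_operators S1.
  by apply: bounded_operatorsD => //; apply/bounded_operatorsZ/bounded_operatorsD.
have bS2 : bounded_operators S2.
  apply: bounded_operatorsD => //; apply/bounded_operatorsZ/bounded_operatorsD => //.
  exact: bounded_operatorsZ.
have i0 : 'i != 0 :> R[i] by rewrite eq_complex /= eqxx oner_eq0.
have i2 : 2 * 'i != 0 :> R[i] by rewrite mulf_neq0// pnatr_eq0.
have xE (x : ces0 R) (x0 : 0 <= x) :
    (x : nat -> R[i]) = (fun k => (normc (x k))%:C).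
  apply/funext => k; have /ces0_geP/(_ k) := x0.
  case: (x k) => s t; rewrite lecE /= => /andP[/eqP -> s0].
  by rewrite expr0n addr0 sqrtr_sqr ger0_norm.
have PE x n : 0 <= x -> P x n = (cesaro_res a (fun k => normc (x k)) n)%:C.
  move=> x0; rewrite -[LHS]/(cesaro_res a%:C x n) {1}(xE _ x0).
  by rewrite [RHS]rmorph_cesaro_res.
(* A positive x has real entries, so conjugating z conjugates the solution; on such x the operators
   Re A_z and Im A_z give the entrywise real and imaginary parts of A_z x. *)
have AcE x n : 0 <= x -> Ac x n = (A x n)^*.
  move=> x0; rewrite [RHS]rmorph_cesaro_res -[LHS]/(cesaro_res z^* x n).
  congr (cesaro_res _ _ n); apply/funext => k /=.
  by rewrite (xE _ x0) /= oppr0.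
have Adom x n : normc (A x n) <= cesaro_res a (fun k => normc (x k)) n.
  exact: normc_cesaro_res.
have pP : positive_op P.
  move=> x x0; apply/ces0_geP => n; rewrite PE// ler0c.
  by apply: cesaro_res_ge0 => // k; exact: normc_ge0.
have ge0_of_norm (r s : R) : `|s| <= r -> 0 <= r%:C + s%:C.
  by rewrite -rmorphD ler0c addrC -lerBlDr sub0r => /ler_normlP[]; rewrite lerNl.
have pS1 : positive_op S1.
  move=> x x0; apply/ces0_geP => n.
  rewrite -[S1 x n]/(P x n + 2^-1 * (A x n + Ac x n)) PE// AcE//.
  rewrite (_ : A x n + (A x n)^* = 2 * (complex.Re (A x n))%:C); last first.
    rewrite mulr_natl; case: (A x n) => s t.
    by apply/eqP; rewrite eq_complex /= subrr addr0 !eqxx.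
  rewrite mulKf ?pnatr_eq0//; apply: ge0_of_norm.
  exact: le_trans (normr_Re_le_normc _) (Adom _ _).
have pS2 : positive_op S2.
  move=> x x0; apply/ces0_geP => n.
  rewrite -[S2 x n]/(P x n + (2 * 'i)^-1 * (A x n + (-1) * Ac x n)) PE// AcE//.
  rewrite (_ : A x n + -1 * (A x n)^* = 2 * 'i * (complex.Im (A x n))%:C); last first.
    rewrite mulN1r -mulrA mulr_natl; case: (A x n) => s t.
    apply/eqP; rewrite eq_complex /= opprK subrr mul0r mul1r mulr0 subrr addr0 add0r.
    by rewrite !mul1r !eqxx.
  rewrite mulKf//; apply: ge0_of_norm.
  exact: le_trans (normr_Im_le_normc _) (Adom _ _).
(* Since S1 - P = Re A and S2 - P = Im A, one has A = S1 + i S2 - (1 + i) P. *)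
exists 4%N, (fun i => nth 0 [:: u; v; v * 'i; - (v * (1 + 'i))] i),
  (fun i => nth id [:: id; S1; S2; P] i); split.
  move=> [[|[|[|[|//]]]] ?] /=; split => //; exact: bounded_operators_id.
move=> x; rewrite !big_ord_recr big_ord0 /= add0r.
apply: ces0_eqP => n.
rewrite -[LHS]/(u * x n + v * A x n).
rewrite -[RHS]/(u * x n + v * (P x n + 2^-1 * (A x n + Ac x n))
  + v * 'i * (P x n + (2 * 'i)^-1 * (A x n + (-1) * Ac x n))
  + - (v * (1 + 'i)) * P x n).
by field.
Qed.

End regularity.

(** * Necessary conditions for invertibility: l nonzero and Re (1/l) < 1 *)

Section spectrum_obstruction.
Context {R : realType}.

(** With q = n+1, the product of the ratios q^2 / (q^2 + K) stays away from 0. The explicit minorant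
    is c exp(2K/q): its exponent drops by 2K/(q(q+1)), at least K/q^2 as q >= 1, and exp(h) >= 1 +
    h. The value of c gives equality with t at index 0. *)
Lemma eventually_bounded_below (t : nat -> R) (K : R) : 0 <= K -> 0 < t 0%N ->
  (forall n, n.+1%:R ^+ 2 * t n <= t n.+1 * (n.+1%:R ^+ 2 + K)) ->
  exists2 c : R, 0 < c & forall n, c <= t n.
Proof.
move=> K0 t0 tS; pose c := t 0%N * expR (- (2 * K)).
have c0 : 0 < c by rewrite mulr_gt0// expR_gt0.
have expR_step (q : R) : 1 <= q ->
    expR (2 * K / (q + 1)) * (q ^+ 2 + K) <= q ^+ 2 * expR (2 * K / q).
  move=> q1; have q0 : 0 < q by apply: lt_le_trans q1.
  have q2 : 0 < q + 1 by rewrite addr_gt0.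
  have -> : 2 * K / q = 2 * K / (q + 1) + 2 * K / (q * (q + 1)).
    by field; rewrite !lt0r_neq0.
  rewrite expRD mulrCA ler_pM2l ?expR_gt0//.
  apply: (@le_trans _ _ (q ^+ 2 * (1 + 2 * K / (q * (q + 1))))); last first.
    by rewrite ler_pM2l ?exprn_gt0// expR_ge1Dx.
  have -> : q ^+ 2 * (1 + 2 * K / (q * (q + 1))) = q ^+ 2 + K * (2 * q / (q + 1)).
    by field; rewrite !lt0r_neq0.
  by rewrite lerD2l ler_peMr// ler_pdivlMr// mul1r mulr_natl mulr2n lerD2l.
have tc n : c * expR (2 * K / n.+1%:R) <= t n.
  elim: n => [|n IHn].
    by rewrite divr1 /c -mulrA -expRD addNr expR0 mulr1.
  rewrite -[n.+2%:R]natr1; set q : R := n.+1%:R.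
  have q1 : 1 <= q by rewrite ler1n.
  have q0 : 0 < q by rewrite ltr0n.
  have pos : 0 < q ^+ 2 + K by rewrite ltr_wpDr// exprn_gt0.
  rewrite -(ler_pM2r pos); apply: le_trans (tS n); rewrite -[leLHS]mulrA.
  apply: le_trans (ler_wpM2l (ltW c0) (expR_step _ q1)) _.
  by rewrite mulrCA ler_wpM2l ?sqr_ge0.
exists c => // n; apply: le_trans (tc n).
by apply: ler_peMr (ltW c0) _; rewrite -[leLHS]expR0 ler_expR divr_ge0 ?mulr_ge0.
Qed.

Lemma sum_delta (n m : nat) : \sum_(0 <= k < m) (k == n)%:R = (n < m)%:R :> R.
Proof.
elim: m => [|m IHm]; first by rewrite big_nil.
rewrite big_nat_recr//= IHm [(n < m.+1)%N]ltnS.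
by case: ltngtP => _; rewrite ?addr0 ?add0r.
Qed.

Lemma abs_mean_delta n m :
  abs_mean (fun k => (k == n)%:R : R[i]) m = (n <= m)%:R / m.+1%:R.
Proof.
rewrite /abs_mean /arithmetic_mean /= /series /= mulrC -ltnS -sum_delta.
by congr (_ / _); apply: eq_bigr => k _; rewrite normc_nat.
Qed.

Lemma delta_ces0 n : (fun k => (k == n)%:R) \in @ces0_pred R.
Proof.
apply/asboolP.
apply: (@squeeze_cvgr _ _ _ _ (fun=> 0) harmonic).
- apply: nearW => m; rewrite abs_mean_ge0/= abs_mean_delta /harmonic /=.
  by rewrite ler_piMl ?invr_ge0// lern1 leq_b1.
- exact: cvg_cst.
- exact: cvg_harmonic.
Qed.

Definition delta_seq n : ces0 R := Ces0 (delta_ces0 n).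

Lemma ces0_rnorm_delta_seq n : ces0_rnorm (delta_seq n) <= n.+1%:R^-1.
Proof.
apply: ces0_rnorm_le => m; rewrite abs_mean_delta.
have [nm|_] := leqP n m; last by rewrite mul0r invr_ge0.
by rewrite mul1r lef_pV2 ?posrE ?ltr0n// ler_nat.
Qed.

Lemma normc_le_abs_mean (x : nat -> R[i]) n :
  normc (x n) <= n.+1%:R * abs_mean x n.
Proof.
rewrite /abs_mean /arithmetic_mean /= mulVKf ?pnatr_eq0// /series /=.
by rewrite big_nat_recr//= lerDr sumr_ge0// => k _; exact: normc_ge0.
Qed.

Lemma normc_mean_le_abs_mean (x : nat -> R[i]) n :
  normc (arithmetic_mean x n) <= abs_mean x n.
Proof.
rewrite /abs_mean /arithmetic_mean /= normcM normcV normc_nat.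
by rewrite ler_wpM2l ?invr_ge0// ler_normc_sum.
Qed.

Lemma bounded_operators_bound (T : ces0 R -> ces0 R) : bounded_operators T ->
  exists M : R, forall x, ces0_rnorm (T x) <= M * ces0_rnorm x.
Proof.
move=> [Tlin Tcont].
pose f := HB.pack_for {linear ces0 R -> ces0 R} T
  (@GRing.isLinear.Build _ _ _ _ T Tlin).
have /linear_boundedP/filter_ex[r rT] : bounded_near f (nbhs (0 : ces0 R)).
  exact/linear_bounded_continuous.
(* An inequality in R[i] entails the one between real parts, and the norms are real. *)
exists (complex.Re r) => x; have := rT x.
rewrite -[`|f x|]/((ces0_rnorm (T x))%:C) -[`|x|]/((ces0_rnorm x)%:C).
by case: (r) => s t; rewrite lecE /= !mulr0 subr0 => /andP[].
Qed.

Lemma invertible_neq0 (l : R[i]) :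
  invertible_in bounded_operators (fun x => l *: x - cesaro_op x) -> l != 0.
Proof.
move=> [S [bS _ SK]]; apply/eqP => l0.
have [M SM] := bounded_operators_bound bS.
(* For l = 0, C x is minus the unit vector at n+1, so x has entry -(n+2) there and norm at least 1,
   while the unit vector has norm at most 1/(n+2). *)
have Sdelta n : n.+2%:R <= M.
  set x := S (delta_seq n.+1).
  have xE k : arithmetic_mean x k = - (k == n.+1)%:R.
    have /(congr1 (fun y : ces0 R => y k)) := SK (delta_seq n.+1).
    rewrite -/x l0 scale0r -[LHS]/(0 - arithmetic_mean x k).
    rewrite -[RHS]/((k == n.+1)%:R) => <-.
    by rewrite sub0r opprK.
  have xn : x n.+1 = - n.+2%:R.
    have := arithmetic_meanS x n; rewrite !xE eqxx ltn_eqF// oppr0 mulr0 add0r.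
    by move/(canLR (divfK _)) => <-; rewrite ?pnatr_eq0// mulN1r.
  have : 1 <= ces0_rnorm x.
    apply: le_trans (le_ces0_rnorm x n.+1).
    rewrite -(@ler_pM2l _ n.+2%:R) ?ltr0n// mulr1.
    apply: le_trans (normc_le_abs_mean _ _).
    by rewrite xn normcN normc_nat.
  move=> /le_trans/(_ (SM _)) M1.
  have M0 : 0 <= M.
    rewrite leNgt; apply/negP => M0.
    have := mulr_le0_ge0 (ltW M0) (ces0_rnorm_ge0 (delta_seq n.+1)).
    by move/(le_trans M1); rewrite ler10.
  have := le_trans M1 (ler_wpM2l M0 (ces0_rnorm_delta_seq n.+1)).
  by rewrite ler_pdivlMr ?ltr0n// mul1r.
have M0 : 0 <= M := le_trans (ler0n _ _) (Sdelta 0%N).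
have := archi_boundP M0; apply/negP; rewrite -leNgt.
by apply: le_trans (Sdelta (Num.bound M)); rewrite ler_nat -addn2 leq_addr.
Qed.

Lemma invertible_Re_lt1 (l : R[i]) :
  invertible_in bounded_operators (fun x => l *: x - cesaro_op x) ->
  complex.Re l^-1 < 1.
Proof.
move=> linv; have l0 := invertible_neq0 linv.
have [S [_ _ SK]] := linv.
rewrite ltNge; apply/negP; set z := l^-1 => z1.
set x := S (delta_seq 0); pose m n := arithmetic_mean x n.
have xE n : x n = z * (m n + (n == 0%N)%:R).
  have /(congr1 (fun y : ces0 R => y n)) := SK (delta_seq 0).
  rewrite -/x -[LHS]/(l * x n - m n) -[RHS]/((n == 0%N)%:R) => <-.
  by rewrite addrC subrK mulKf.
(* If m 0 = 0, then x 0 = 0, while the relation at index 0 gives x 0 = z = 1/l. *)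
have m0 : m 0%N != 0.
  apply/eqP => m0; have := xE 0%N.
  rewrite m0 -[x 0%N]arithmetic_mean0 -/(m 0%N) m0 add0r mulr1 => /esym/eqP.
  by rewrite invr_eq0 (negPf l0).
have mS n : m n.+1 * (n.+2%:R - z) = n.+1%:R * m n.
  have := arithmetic_meanS x n; rewrite -/(m _) -/(m n) xE addr0.
  move=> /(canLR (divfK _)) e; rewrite mulrBr e ?pnatr_eq0//; ring.
pose K := normc z ^+ 2.
have [c c0 mc] : exists2 c : R, 0 < c & forall n, c <= normc (m n) ^+ 2.
  apply: (@eventually_bounded_below _ K); first exact: sqr_ge0.
    rewrite exprn_gt0// lt_neqAle normc_ge0 andbT eq_sym.
    by apply: contra m0 => /eqP/eq0_normc ->.
  move=> n; rewrite -exprMn -[n.+1%:R in leLHS](@normc_nat R) -normcM -mS normcM exprMn.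
  (* It remains to see |q + 1 - z|^2 <= q^2 + |z|^2 for q = n+1. With s = Re z >= 1, this follows
     from (q + 1 - s)^2 <= q^2 + (s - 1)^2 <= q^2 + s^2. *)
  rewrite ler_wpM2l ?sqr_ge0//.
  have natE : n.+2%:R = (n.+1%:R + 1)%:C :> R[i].
    by rewrite -natr1 rmorphD rmorph1 rmorph_nat.
  rewrite natE /K; case: (z) z1 => s t /= s1.
  rewrite !sqr_sqrtr ?addr_ge0 ?sqr_ge0// sub0r sqrrN.
  rewrite [leRHS]addrA lerD2r; have : 0 <= n.+1%:R :> R by [].
  move: (n.+1%:R) => q q0; nra.
have xx0 : abs_mean x n * abs_mean x n @[n --> \oo] --> (0 : R).
  by rewrite -[X in _ --> X](mulr0 0); apply: cvgM; exact: abs_mean_cvg0.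
suff : c <= 0 by rewrite leNgt c0.
(* The means of x are dominated by those of |x|, which tend to 0, against |m n|^2 >= c > 0. *)
apply: (ler_cvg_to (cvg_cst c) xx0).
apply: nearW => n; apply: le_trans (mc n) _.
by rewrite expr2 ler_pM ?normc_ge0// normc_mean_le_abs_mean.
Qed.

End spectrum_obstruction.

Theorem proposition5p2 (R : realType) :
  [/\ bounded_operators (@cesaro_op R),
      positive_op (@cesaro_op R) &
      order_spectrum (@cesaro_op R) = spectrum (@cesaro_op R)].
Proof.
split; [exact: cesaro_op_bounded|exact: cesaro_op_positive|].
(* Both inclusions are contrapositives of implications between the two kinds of invertibility;
   passing from a regular inverse to a bounded one comes first. *)
apply/seteqP; split => l /= linv; apply: contra_not linv; last first.
  by move=> [S [/regular_bounded bS ? ?]]; exists S.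
move=> linv; have l0 := invertible_neq0 linv.
have z1 := invertible_Re_lt1 linv.
(* Re (1/l) may be negative, whereas the dominating operator A_a requires 0 <= a < 1. *)
pose a := Num.max (complex.Re l^-1) 0.
have za : complex.Re l^-1 <= a by rewrite le_max lexx.
have a_ge0 : 0 <= a by rewrite le_max lexx orbT.
have a_lt1 : a < 1 by rewrite gt_max z1 ltr01.
exists (fun x => l^-1 *: x + l^-1 ^+ 2 *: cesaro_res_op za a_ge0 a_lt1 x).
split; first exact: regular_cesaro_res_op.
- by move=> x; have [] := cesaro_res_op_inverse za a_ge0 a_lt1 x l0 erefl.
- by move=> x; have [] := cesaro_res_op_inverse za a_ge0 a_lt1 x l0 erefl.
Qed.
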